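(* Let $(\mathcal{M},(\cdot,\cdot))$ be a $d$-dimensional Riemannian manifold, let $\mathbf{p}\in\mathcal{M}$, and let $\mathcal{S}\subset T_{\mathbf{p}}\mathcal{M}^{d_1\times\cdots\times d_n}$ be any subset. Let $\mathcal{X}\in\mathcal{M}^{d_1\times\cdots\times d_n}$ be a manifold-valued tensor (with $\log_{\mathbf{p}}\mathcal{X}$ well-defined), let $(\kappa^m)_{m=1}^\infty\subset\mathbb{R}^{d_1\times\cdots\times d_n\times d}$ be any sequence of real-valued tensors such that each $\kappa^m_{j_1,\ldots,j_n,j}\to0$ as $m\to\infty$, and consider the corresponding functions $F(\,\cdot\,;\kappa^m):T_{\mathbf{p}}\mathcal{M}^{d_1\times\cdots\times d_n}\to\mathbb{R}$, $$F(\Xi_{\mathbf{p}};\kappa^m)=\sum_{j_1,\ldots,j_n,j=1}^{d_1,\ldots,d_n,d}\beta(\kappa^m_{j_1,\ldots,j_n,j})^2\bigl(\Xi_{\mathbf{p}}-\log_{\mathbf{p}}\mathcal{X},\Theta_{\mathbf{p}}^{j_1,\ldots,j_n,j}\bigr)_{\mathbf{p}}^2 ,$$ where $\{\Theta_{\mathbf{p}}^{j_1,\ldots,j_n,j}\}$ is a fixed orthonormal basis of $T_{\mathbf{p}}\mathcal{M}^{d_1\times\cdots\times d_n}$. If $\mathcal{S}$ is closed with respect to $\|\cdot\|_{\mathbf{p}}$ on $T_{\mathbf{p}}\mathcal{M}^{d_1\times\cdots\times d_n}$, then the sequence of minimizers $(\Xi_{\mathbf{p}}^{*,m})_{m=1}^\infty\subset\mathcal{S}$,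 where $\Xi_{\mathbf{p}}^{*,m}$ minimizes $F(\,\cdot\,;\kappa^m)$ over $\mathcal{S}$, converges in $\|\cdot\|_{\mathbf{p}}$ to a minimizer of the zero-curvature case: $$\Xi_{\mathbf{p}}^{*,m}\to\Xi_{\mathbf{p}}^{*}\in\operatorname*{arg\,min}_{\Xi_{\mathbf{p}}\in\mathcal{S}}\|\Xi_{\mathbf{p}}-\log_{\mathbf{p}}\mathcal{X}\|_{\mathbf{p}}^2 .$$
   Context: $\mathcal{M}^{d_1\times\cdots\times d_n}$ is the space of arrays $\mathcal{X}=(\mathcal{X}_{i_1,\ldots,i_n})$, $1\le i_k\le d_k$, with entries in $\mathcal{M}$, with the product Riemannian metric. $T_{\mathbf{p}}\mathcal{M}^{d_1\times\cdots\times d_n}:=(T_{\mathbf{p}}\mathcal{M})^{d_1\times\cdots\times d_n}$ carries the product inner product $(\cdot,\cdot)_{\mathbf{p}}$ (sum of entrywise inner products) and norm $\|\cdot\|_{\mathbf{p}}$. $\log_{\mathbf{p}}$ acts entrywise; it is the inverse of $\exp_{\mathbf{p}}$ restricted to a set $\mathcal{G}'_{\mathbf{p}}\subset T_{\mathbf{p}}\mathcal{M}$ on which $\exp_{\mathbf{p}}$ is a diffeomorphism onto its image, and $\log_{\mathbf{p}}\mathcal{X}$ is well-defined when all entries of $\mathcal{X}$ lie in $\exp_{\mathbf{p}}(\mathcal{G}'_{\mathbf{p}})$. The function $\beta:\mathbb{R}\to\mathbb{R}$ is $$\beta(\kappa):=\begin{cases}\sinh(\sqrt{-\kappa})/\sqrt{-\kappa},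 & \kappa<0,\\ 1, & \kappa=0,\\ \sin(\sqrt{\kappa})/\sqrt{\kappa}, & \kappa>0.\end{cases}$$ Note $F(\Xi_{\mathbf{p}};0)=\|\Xi_{\mathbf{p}}-\log_{\mathbf{p}}\mathcal{X}\|_{\mathbf{p}}^2$.
   Formalization: Whole-sequence convergence fails if the zero-curvature minimizer is not unique; proved instead: distance to the argmin tends to 0, every subsequence has a further subsequence converging to a minimizer, and the whole sequence converges when the minimizer is unique. *)

(* Defs.v *)
From HB Require Import structures.
From mathcomp Require Export all_boot all_order all_algebra.
From mathcomp Require Export all_classical all_reals all_analysis.
Export Order.TTheory GRing.Theory Num.Theory.
Export numFieldNormedType.Exports.

Set Implicit Arguments.
Unset Strict Implicit.
Unset Printing Implicit Defensive.

Local Open Scope classical_set_scope.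
Local Open Scope ring_scope.

(* Only meaningful for U open: differentiability and directional derivatives at
   a point of U then depend on the restriction of f to U alone.  In finite
   dimension this is the usual C^k. *)
Fixpoint Ck_on (R : realType) (V W : normedModType R) (k : nat)
    (U : set V) (f : V -> W) : Prop :=
  match k with
  | 0 => forall x, U x -> {for x, continuous f}
  | k'.+1 => (forall x, U x -> differentiable f x) /\
             (forall v, Ck_on k' U ('D_v f))
  end.

Definition smooth_on (R : realType) (V W : normedModType R)
    (U : set V) (f : V -> W) : Prop := forall k, Ck_on k U f.

(* [cmap] and [cinv] are total functions; their values outside [dom] and
   [cimg] respectively are irrelevant. *)
Record chart (R : realType) (d : nat) (M : topologicalType) := Chart {
  dom : set M;
  cmap : M -> 'rV[R]_d;
  cinv : 'rV[R]_d -> M;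
  dom_open : open dom;
  cimg_open : open (cmap @` dom);
  cmapK : forall q, dom q -> cinv (cmap q) = q;
  cmap_continuous : forall q, dom q -> {for q, continuous cmap};
  cinv_continuous : forall x, (cmap @` dom) x -> {for x, continuous cinv} }.

Definition cimg (R : realType) (d : nat) (M : topologicalType)
  (c : chart R d M) : set 'rV[R]_d := cmap c @` dom c.

Record smoothManifold (R : realType) (d : nat) := SmoothManifold {
  carrier :> topologicalType;
  atlas : set (chart R d carrier);
  carrier_hausdorff : hausdorff_space carrier;
  carrier_second_countable : @second_countable carrier;
  atlas_cover : forall q : carrier, exists2 c, atlas c & dom c q;
  atlas_smooth : forall c1 c2, atlas c1 -> atlas c2 ->
    smooth_on (cmap c1 @` (dom c1 `&` dom c2)) (cmap c2 \o cinv c1) }.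

Definition chart_at (R : realType) (d : nat) (M : smoothManifold R d) (p : M)
  (c : chart R d M) : Prop := atlas c /\ dom c p.

(* A tangent vector at p is the family of its coordinate vectors, one for each
   chart around p, related by the differentials of the transition maps (and
   set to 0 on all the other charts). *)
Definition is_tangent (R : realType) (d : nat) (M : smoothManifold R d) (p : M)
    (v : chart R d M -> 'rV[R]_d) : Prop :=
  (forall c, ~ chart_at p c -> v c = 0) /\
  (forall c1 c2, chart_at p c1 -> chart_at p c2 ->
     v c2 = 'd (cmap c2 \o cinv c1) (cmap c1 p) (v c1)).

Section TangentSpace.
Context (R : realType) (d : nat) (M : smoothManifold R d) (p : M).

Definition tangent_pred : {pred chart R d M -> 'rV[R]_d} :=
  fun v => `[< is_tangent p v >].

Lemma tangent_submod_closed : submod_closed tangent_pred.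
Proof.
split.
  by apply/asboolP; split => // c1 c2 _ _; rewrite linear0.
move=> a u v /asboolP[u0 uE] /asboolP[v0 vE]; apply/asboolP; split => [c cp|].
  by rewrite -[LHS]/(a *: u c + v c) u0 // v0 // addr0 scaler0.
move=> c1 c2 p1 p2.
rewrite -[LHS]/(a *: u c2 + v c2) -[X in _ = _ X]/(a *: u c1 + v c1).
by rewrite linearP -(uE _ _ p1 p2) -(vE _ _ p1 p2).
Qed.

HB.instance Definition _ :=
  GRing.isSubmodClosed.Build R (chart R d M -> 'rV[R]_d) tangent_pred
    tangent_submod_closed.

Record tangent := Tangent {
  coord :> chart R d M -> 'rV[R]_d;
  coordP : coord \in tangent_pred }.

HB.instance Definition _ := [isSub for coord].
HB.instance Definition _ := [Choice of tangent by <:].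
HB.instance Definition _ := [SubChoice_isSubLmodule of tangent by <:].

(* Every x : 'rV_d is the coordinate vector of exactly one tangent vector in any
   chart c around p, so the default value 0 is not used there. *)
Definition tangent_of (c : chart R d M) (x : 'rV[R]_d) : tangent :=
  xget 0 [set v : tangent | v c = x].

End TangentSpace.

Definition gram (R : realType) (d : nat) (M : smoothManifold R d)
    (g : forall p : M, tangent p -> tangent p -> R)
    (c : chart R d M) (x : 'rV[R]_d) : 'M[R]_d :=
  \matrix_(i, j) g (cinv c x) (tangent_of (cinv c x) c (delta_mx 0 i))
                              (tangent_of (cinv c x) c (delta_mx 0 j)).

Record riemannianManifold (R : realType) (d : nat) := RiemannianManifold {
  smoothManifold_of :> smoothManifold R d;
  metric : forall p : smoothManifold_of, tangent p -> tangent p -> R;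
  metricC : forall p (u v : tangent p), metric u v = metric v u;
  metricDZl : forall p (a : R) (u v w : tangent p),
    metric (a *: u + v) w = a * metric u w + metric v w;
  metric_gt0 : forall p (v : tangent p), v != 0 -> 0 < metric v v;
  metric_smooth : forall c, atlas c -> smooth_on (cimg c) (gram metric c) }.

Definition christoffel (R : realType) (d : nat) (M : riemannianManifold R d)
    (c : chart R d M) (k i j : 'I_d) (x : 'rV[R]_d) : R :=
  let G := gram (@metric R d M) c in
  let pd (l a b : 'I_d) := 'D_(delta_mx 0 l) (fun y => G y a b) x in
  2^-1 * \sum_(l < d) invmx (G x) k l * (pd i j l + pd j i l - pd l i j).

Definition is_geodesic (R : realType) (d : nat) (M : riemannianManifold R d)
    (a b : R) (gamma : R -> M) : Prop :=
  forall t, a < t < b ->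
    {for t, continuous gamma} /\
    forall c : chart R d M, chart_at (gamma t) c ->
      let x : R -> 'rV[R]_d := cmap c \o gamma in
      [/\ derivable x t 1, derivable (derive1 x) t 1 &
        forall k, (derive1 (derive1 x) t) 0 k +
          \sum_(i < d) \sum_(j < d) christoffel c k i j (x t) *
            (derive1 x t) 0 i * (derive1 x t) 0 j = 0].

Definition exp_rel (R : realType) (d : nat) (M : riemannianManifold R d) (p : M)
    (v : tangent p) (q : M) : Prop :=
  exists a b : R, exists gamma : R -> M,
    [/\ a < 0, 1 < b, is_geodesic a b gamma, gamma 0 = p & gamma 1 = q] /\
    forall c : chart R d M, chart_at p c -> derive1 (cmap c \o gamma) 0 = v c.

(* M need not be complete: the default value p is returned when the geodesic
   with initial velocity v is not defined up to time 1. *)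
Definition rexp (R : realType) (d : nat) (M : riemannianManifold R d) (p : M)
    (v : tangent p) : M :=
  xget p [set q | exp_rel v q].

Definition rlog (R : realType) (d : nat) (M : riemannianManifold R d) (p : M)
    (G : set (tangent p)) (q : M) : tangent p :=
  xget 0 [set v | G v /\ rexp v = q].

(* The tangent space at p is identified with 'rV_d through any chart around p
   to express openness and smoothness. *)
Definition exp_diffeo_on (R : realType) (d : nat) (M : riemannianManifold R d)
    (p : M) (G : set (tangent p)) : Prop :=
  [/\ forall v, G v -> exists q, exp_rel v q,
      forall u v, G u -> G v -> rexp u = rexp v -> u = v,
      open (@rexp R d M p @` G) &
      forall c : chart R d M, chart_at p c ->
        open ((fun v : tangent p => v c) @` G) /\
        forall c' : chart R d M, atlas c' ->
          let Gc' := G `&` [set v | dom c' (rexp v)] in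
          let expc := fun x => cmap c' (rexp (tangent_of p c x)) in
          let logc := fun y => rlog G (cinv c' y) c in
          [/\ open ((fun v : tangent p => v c) @` Gc'),
              smooth_on ((fun v : tangent p => v c) @` Gc') expc &
              smooth_on (cmap c' @` (dom c' `&` (@rexp R d M p @` G))) logc]].

Definition multi_index (n : nat) (dims : 'I_n -> nat) : finType :=
  {dffun forall k : 'I_n, 'I_(dims k)}.

Definition tangent_tensor (R : realType) (d : nat) (M : riemannianManifold R d)
    (p : M) (n : nat) (dims : 'I_n -> nat) : lmodType R :=
  {ffun multi_index dims -> tangent p}.

Section TangentTensor.
Context (R : realType) (d : nat) (M : riemannianManifold R d) (p : M).
Context (n : nat) (dims : 'I_n -> nat).
Local Notation T := (tangent_tensor p dims).

Definition tinner (Xi Eta : T) : R := \sum_i metric (Xi i) (Eta i).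

Definition tnorm (Xi : T) : R := Num.sqrt (tinner Xi Xi).

Definition tlog (G : set (tangent p)) (X : {ffun multi_index dims -> M}) : T :=
  [ffun i => rlog G (X i)].

Definition tcvg (Xi : nat -> T) (Eta : T) : Prop :=
  (fun m => tnorm (Xi m - Eta)) @ \oo --> 0.

Definition topen (U : set T) : Prop :=
  forall Xi, U Xi -> exists2 e : R, 0 < e & forall Eta, tnorm (Eta - Xi) < e -> U Eta.

Definition tclosed (S : set T) : Prop := topen (~` S).

Definition orthonormal_basis (Theta : multi_index dims -> 'I_d -> T) : Prop :=
  (forall i j i' j',
     tinner (Theta i j) (Theta i' j') = ((i == i') && (j == j'))%:R) /\
  (forall Xi : T, exists a : multi_index dims -> 'I_d -> R,
     Xi = \sum_i \sum_(j < d) a i j *: Theta i j).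

Definition argmin (F : T -> R) (S : set T) : set T :=
  [set Xi | S Xi /\ forall Eta, S Eta -> F Xi <= F Eta].

End TangentTensor.

Definition sinh (R : realType) (x : R) : R := (expR x - expR (- x)) / 2.

Definition beta (R : realType) (k : R) : R :=
  if k < 0 then sinh (Num.sqrt (- k)) / Num.sqrt (- k)
  else if k == 0 then 1
  else sin (Num.sqrt k) / Num.sqrt k.

Definition curvF (R : realType) (d : nat) (M : riemannianManifold R d) (p : M)
    (n : nat) (dims : 'I_n -> nat) (G : set (tangent p))
    (X : {ffun multi_index dims -> M})
    (Theta : multi_index dims -> 'I_d -> tangent_tensor p dims)
    (kappa : multi_index dims -> 'I_d -> R) (Xi : tangent_tensor p dims) : R :=
  \sum_i \sum_(j < d)
    beta (kappa i j) ^+ 2 * tinner (Xi - tlog G X) (Theta i j) ^+ 2.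

(* Main.v *)
(* Since beta is continuous at 0 with beta 0 = 1, the weights tend to 1.  This
   bounds the coordinates of the minimizers in the orthonormal basis, so by
   Bolzano-Weierstrass every subsequence has a convergent further subsequence;
   passing to the limit in F(Xi_m) <= F(Z) for each fixed competitor Z shows, by
   Parseval, that its limit minimizes the distance to log X over S.  Convergence
   to the set of minimizers then follows by contradiction. *)

Require Import Defs.
From mathcomp Require Import lra.

Set Implicit Arguments.
Unset Strict Implicit.
Unset Printing Implicit Defensive.

Local Open Scope classical_set_scope.
Local Open Scope ring_scope.

(** * Extraction of convergent subsequences *)

Section Subsequences.
Context (R : realType).
Implicit Types (u : nat -> R) (t : nat -> nat).

Lemma homo_ltn_cvg_infty t : {homo t : a b / (a < b)%N} -> t @ \oo --> \oo.
Proof.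
move=> t_lt; have le_t n : (n <= t n)%N.
  by elim: n => // n IHn; apply: (leq_ltn_trans IHn); exact: t_lt.
apply/cvgnyPge => A; near=> n; apply: leq_trans (le_t n).
by near: n; exact: nbhs_infty_ge.
Unshelve. all: by end_near. Qed.

Lemma cvg_subseq (T : topologicalType) (u : nat -> T) (a : T) t :
  {homo t : a b / (a < b)%N} -> u @ \oo --> a -> (u \o t) @ \oo --> a.
Proof. by move=> /homo_ltn_cvg_infty t_oo; exact: cvg_comp. Qed.

(** Bolzano-Weierstrass is applied to the tail shifted by [N], which is bounded throughout; adding
    [N] back gives indices into [u] itself. *)
Lemma eventually_bounded_cvg_subseq u (B : R) :
  (\forall n \near \oo, `|u n| <= B) ->
  exists2 t, {homo t : a b / (a < b)%N} & cvgn (u \o t).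
Proof.
move=> [N _ uB].
have [|f f_inc u_cvg] := @bolzano_weierstrass R (fun n => u (n + N)%N).
  exists B; split; first exact: num_real.
  by move=> x Bx n _ /=; apply: (le_trans (uB _ _) (ltW Bx)) => /=; exact: leq_addl.
exists (fun n => (f n + N)%N) => // a b ab; rewrite ltn_add2r.
by rewrite (leqW_mono f_inc).
Qed.

(** Induction on [l]: each index refines the subsequence found so far, and limits already obtained
    survive the refinement. *)
Lemma bounded_family_cvg_subseq (I : eqType) (l : seq I) (u : nat -> I -> R) :
  (forall i, exists B : R, \forall n \near \oo, `|u n i| <= B) ->
  exists2 t, {homo t : a b / (a < b)%N} &
    forall i, i \in l -> cvgn (fun n => u (t n) i).
Proof.
move=> uB; elim: l => [|i l [t t_lt tP]]; first by exists id.
have [B iB] := uB i.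
have [|r r_lt rP] := @eventually_bounded_cvg_subseq (fun n => u (t n) i) B.
  by move: (homo_ltn_cvg_infty t_lt) => /(_ _ iB).
exists (t \o r) => [a b ab /=|j]; first by apply: t_lt; exact: r_lt.
rewrite inE => /predU1P[-> //|/tP /cvg_ex[a ua]].
by apply/cvg_ex; exists a; exact: (cvg_subseq r_lt ua).
Qed.

End Subsequences.

(** * Continuity of [beta] at zero *)

Section BetaLimit.
Context (R : realType).

(* At the origin the difference quotient of [f] is [f h / h]. *)
Lemma cvg_div_id_dnbhs0 (f : R -> R) (a : R) :
  is_derive (0 : R) 1 f a -> f 0 = 0 -> f h / h @[h --> 0^'] --> a.
Proof.
move=> f_der f0; have [f_ex f_val] := f_der.
rewrite -f_val; apply: cvg_trans f_ex.
apply: near_eq_cvg; near=> h.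
by rewrite /= f0 subr0 addr0 scaler1 /GRing.scale/= mulrC.
Unshelve. all: by end_near. Qed.

(** Away from 0, [beta k] is [f h / h] at [h = Num.sqrt |k|], where [f] is [sinh] or [sin]; both
    have derivative 1 at 0, and [h] tends to 0 with [k]. *)
Lemma cvg_beta0 : @beta R k @[k --> 0] --> (1 : R).
Proof.
have sinh_cvg : @sinh R h / h @[h --> 0^'] --> (1 : R).
  apply: cvg_div_id_dnbhs0; last by rewrite /sinh oppr0 subrr mul0r.
  rewrite /sinh; apply: is_derive_eq.
  rewrite oppr0 expR0 subrr scale0r add0r /GRing.scale/=; lra.
have sin_cvg : @sin R h / h @[h --> 0^'] --> (1 : R).
  apply: cvg_div_id_dnbhs0; last exact: sin0.
  by apply: is_derive_eq; exact: cos0.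
have sqrt_cvg : Num.sqrt `|k| @[k --> (0 : R)] --> (0 : R).
  rewrite -[X in _ --> X]sqrtr0 -[X in Num.sqrt X](normr0 R).
  by apply: continuous_comp; [exact: norm_continuous|exact: sqrt_continuous].
apply/cvgrPdist_lt => e e0.
have /cvgrPdist_lt/(_ e e0) := sinh_cvg.
move=> /nbhs_ballP[d1 /= d1_gt0 sinh_lt].
have /cvgrPdist_lt/(_ e e0) := sin_cvg.
move=> /nbhs_ballP[d2 /= d2_gt0 sin_lt].
near=> k.
have : Num.sqrt `|k| < Num.min d1 d2.
  near: k; apply: (cvgr_lt _ sqrt_cvg).
  by rewrite lt_min d1_gt0.
rewrite lt_min => /andP[k1 k2].
rewrite /beta; case: (ltgtP k 0) => [k0|k0|_]; last by rewrite subrr normr0.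
- rewrite ltr0_norm // in k1; apply: sinh_lt => /=.
    by rewrite /ball/= sub0r normrN ger0_norm ?sqrtr_ge0.
  by rewrite gt_eqF // sqrtr_gt0 oppr_gt0.
- rewrite gtr0_norm // in k2; apply: sin_lt => /=.
    by rewrite /ball/= sub0r normrN ger0_norm ?sqrtr_ge0.
  by rewrite gt_eqF // sqrtr_gt0.
Unshelve. all: by end_near. Qed.

End BetaLimit.

(** * Coordinates, limits and minimizers in the space of tangent tensors *)

Section TensorInner.
Context (R : realType) (d : nat) (M : riemannianManifold R d) (p : M).
Context (n : nat) (dims : 'I_n -> nat).
Local Notation T := (tangent_tensor p dims).
Implicit Types Xi Eta Z : T.

Lemma tinnerC Xi Eta : tinner Xi Eta = tinner Eta Xi.
Proof. by apply: eq_bigr => i _; exact: metricC. Qed.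

Lemma tinnerDZl (a : R) Xi Eta Z :
  tinner (a *: Xi + Eta) Z = a * tinner Xi Z + tinner Eta Z.
Proof.
rewrite /tinner mulr_sumr -big_split; apply: eq_bigr => i _ /=.
by rewrite !ffunE metricDZl.
Qed.

Lemma tinnerDl Xi Eta Z : tinner (Xi + Eta) Z = tinner Xi Z + tinner Eta Z.
Proof. by rewrite -[Xi]scale1r tinnerDZl mul1r scale1r. Qed.

Lemma tinner0l Z : tinner 0 Z = 0.
Proof. by apply: (addrI (tinner 0 Z)); rewrite -tinnerDl !addr0. Qed.

Lemma tinnerZl (a : R) Xi Z : tinner (a *: Xi) Z = a * tinner Xi Z.
Proof. by rewrite -[a *: Xi]addr0 tinnerDZl tinner0l addr0. Qed.

Lemma tinnerBl Xi Eta Z : tinner (Xi - Eta) Z = tinner Xi Z - tinner Eta Z.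
Proof. by rewrite tinnerDl -scaleN1r tinnerZl mulN1r. Qed.

Lemma tinner_suml (I : Type) (r : seq I) (P : pred I) (F : I -> T) Z :
  tinner (\sum_(i <- r | P i) F i) Z = \sum_(i <- r | P i) tinner (F i) Z.
Proof.
exact: (big_morph (fun Y => tinner Y Z) (fun Xi Eta => tinnerDl Xi Eta Z) (tinner0l Z)).
Qed.

Section OrthonormalBasis.
Context (Theta : multi_index dims -> 'I_d -> T).
Hypothesis hTheta : orthonormal_basis Theta.

Lemma tinner_coord (a : multi_index dims -> 'I_d -> R) i j :
  tinner (\sum_k \sum_(l < d) a k l *: Theta k l) (Theta i j) = a i j.
Proof.
rewrite tinner_suml (bigD1 i)//= tinner_suml (bigD1 j)//=.
rewrite tinnerZl hTheta.1 !eqxx mulr1 !big1 ?addr0// => [k ki|l lj].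
  rewrite tinner_suml big1// => l _.
  by rewrite tinnerZl hTheta.1 (negbTE ki) mulr0.
by rewrite tinnerZl hTheta.1 eqxx (negbTE lj) mulr0.
Qed.

Lemma tinner_parseval Xi :
  tinner Xi Xi = \sum_i \sum_(j < d) tinner Xi (Theta i j) ^+ 2.
Proof.
have [a XiE] := hTheta.2 Xi.
(* Only the left copy of [Xi] is expanded; its coefficients are recognised as inner products at the
   end. *)
rewrite {1}XiE tinner_suml; apply: eq_bigr => i _.
rewrite tinner_suml; apply: eq_bigr => j _.
by rewrite tinnerZl tinnerC expr2 {2}XiE tinner_coord.
Qed.

Lemma tnorm_sqr Xi :
  tnorm Xi ^+ 2 = \sum_i \sum_(j < d) tinner Xi (Theta i j) ^+ 2.
Proof.
rewrite -tinner_parseval sqr_sqrtr// tinner_parseval.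
by do 2!apply: sumr_ge0 => ? _; exact: sqr_ge0.
Qed.

Lemma cvg_sum2 (F : nat -> multi_index dims -> 'I_d -> R)
    (a : multi_index dims -> 'I_d -> R) :
  (forall i j, F m i j @[m --> \oo] --> a i j) ->
  \sum_i \sum_(j < d) F m i j @[m --> \oo] --> \sum_i \sum_(j < d) a i j.
Proof.
by move=> Fa; do 2!(apply: cvg_big => [|? _]; first exact: add_continuous).
Qed.

(** By Parseval the squared distance is a finite sum of squared coordinate differences. *)
Lemma tcvg_coord (Y : nat -> T) Eta :
  (forall i j, tinner (Y m) (Theta i j) @[m --> \oo] --> tinner Eta (Theta i j)) ->
  tcvg Y Eta.
Proof.
move=> Ycvg.
have sq_cvg : tinner (Y m - Eta) (Y m - Eta) @[m --> \oo] --> (0 : R).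
  have -> : (0 : R) = \sum_(i : multi_index dims) \sum_(j < d) 0.
    by rewrite big1// => i _; rewrite big1.
  under eq_fun do rewrite tinner_parseval.
  apply: (cvg_sum2 (F := fun m i j => _) (a := fun _ _ => 0)) => i j.
  rewrite -[X in _ --> X](mulr0 (0 : R)).
  rewrite -{1 2}(subrr (tinner Eta (Theta i j))).
  under eq_fun do rewrite tinnerBl expr2.
  by apply: cvgM; apply: cvgB => //; exact: cvg_cst.
rewrite /tcvg -[X in _ --> X]sqrtr0.
by apply: continuous_cvg; [exact: sqrt_continuous|exact: sq_cvg].
Qed.

(** The weights tend to 1, which leaves the Parseval sum. Since [Y] may vary with [m], this covers
    both the minimizers and a constant competitor. *)
Lemma curvF_cvg (G : set (tangent p)) (X : {ffun multi_index dims -> M})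
    (kappa : nat -> multi_index dims -> 'I_d -> R)
    (hkappa : forall i j, (fun m => kappa m i j) @ \oo --> 0)
    (Y : nat -> T) Eta :
  (forall i j, tinner (Y m - tlog G X) (Theta i j) @[m --> \oo] -->
               tinner (Eta - tlog G X) (Theta i j)) ->
  curvF G X Theta (kappa m) (Y m) @[m --> \oo] --> tnorm (Eta - tlog G X) ^+ 2.
Proof.
move=> Ycvg; rewrite tnorm_sqr; apply: (cvg_sum2 (F := fun m i j => _) (a := fun i j => _)) => i j.
rewrite -[X in _ --> X]mul1r -[in X in _ --> X](expr1n _ 2) !expr2.
have beta1 : beta (kappa m i j) @[m --> \oo] --> (1 : R).
  exact: (cvg_comp _ _ (hkappa i j) (@cvg_beta0 R)).
under eq_fun do rewrite !expr2.
by do 2!apply: cvgM; rewrite ?expr2.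
Qed.

End OrthonormalBasis.

(** A limit outside [S] would have a ball avoiding [S], yet some [Y m] lies in that ball. *)
Lemma tclosed_cvg (S : set T) (Y : nat -> T) Eta :
  tclosed S -> (forall m, S (Y m)) -> tcvg Y Eta -> S Eta.
Proof.
move=> S_closed SY YEta; apply: contrapT => /S_closed[e e0 eS].
have /cvgrPdist_lt/(_ e e0)[N _ /(_ N (leqnn N))] := YEta.
by rewrite /= sub0r normrN ger0_norm ?sqrtr_ge0// => /eS; apply; exact: SY.
Qed.

(* For small curvatures all weights are at least 1/2, so the coordinates of the
   minimizers are controlled by the values at the fixed competitor [Xi 0]. *)
Lemma curvF_argmin_subseq (S : set T) (G : set (tangent p))
    (X : {ffun multi_index dims -> M})
    (kappa : nat -> multi_index dims -> 'I_d -> R)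
    (hkappa : forall i j, (fun m => kappa m i j) @ \oo --> 0)
    (Theta : multi_index dims -> 'I_d -> T) (hTheta : orthonormal_basis Theta)
    (hS : tclosed S) (Xi : nat -> T)
    (hXi : forall m, argmin (curvF G X Theta (kappa m)) S (Xi m)) :
  exists2 t : nat -> nat, {homo t : a b / (a < b)%N} &
    exists2 Eta, argmin (fun Eta => tnorm (Eta - tlog G X) ^+ 2) S Eta &
      tcvg (Xi \o t) Eta.
Proof.
pose L := tlog G X.
pose u m (ij : multi_index dims * 'I_d) := tinner (Xi m - L) (Theta ij.1 ij.2).
have F_cvg Z :
    curvF G X Theta (kappa m) Z @[m --> \oo] --> tnorm (Z - L) ^+ 2.
  by apply: (curvF_cvg hTheta hkappa (Y := fun=> Z)) => i j; exact: cvg_cst.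
have u_bounded ij : exists B : R, \forall m \near \oo, `|u m ij| <= B.
  (* [B] exceeds the limit of the values at [Xi 0], so it eventually bounds them; a weight above 1/2
     then gives [u ^+ 2 <= 2 * B]. *)
  pose B := tnorm (Xi 0 - L) ^+ 2 + 1; exists (2 * B + 1).
  have beta1 : beta (kappa m ij.1 ij.2) ^+ 2 @[m --> \oo] --> (1 : R).
    rewrite -[X in _ --> X](mulr1 (1 : R)); under eq_fun do rewrite expr2.
    by apply: cvgM; exact: (cvg_comp _ _ (hkappa _ _) (@cvg_beta0 R)).
  near=> m.
  have w_ge : 1 / 2 < beta (kappa m ij.1 ij.2) ^+ 2.
    by near: m; apply: (cvgr_gt _ beta1); lra.
  have F_le : curvF G X Theta (kappa m) (Xi 0) < B.
    by near: m; apply: (cvgr_lt _ (F_cvg (Xi 0))); rewrite ltrDl.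
  have term_le : beta (kappa m ij.1 ij.2) ^+ 2 * u m ij ^+ 2 <=
      curvF G X Theta (kappa m) (Xi m).
    rewrite /curvF (bigD1 ij.1)//= (bigD1 ij.2)//= -addrA lerDl addr_ge0//.
      by apply: sumr_ge0 => j _; rewrite mulr_ge0 ?sqr_ge0.
    by do 2!apply: sumr_ge0 => ? _; rewrite mulr_ge0 ?sqr_ge0.
  (* Being a minimizer itself, [Xi 0] lies in [S] and can compete at every [m]. *)
  have min_le := (hXi m).2 _ (hXi 0%N).1.
  have u_sqr : u m ij ^+ 2 <= 2 * B by have := sqr_ge0 (u m ij); nra.
  (* These squares give [2 * |u| <= u ^+ 2 + 1], which avoids a square root in the bound. *)
  have := sqr_ge0 (u m ij - 1); have := sqr_ge0 (u m ij + 1).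
  by rewrite ler_norml; nra.
have [t t_lt ut] := bounded_family_cvg_subseq (enum {: multi_index dims * 'I_d}) u_bounded.
pose a i j : R := limn (fun m => u (t m) (i, j)).
(* The candidate limit is rebuilt from its limit coordinates, which are centred at [L]. *)
pose Eta := L + \sum_i \sum_(j < d) a i j *: Theta i j.
have EtaE i j : tinner (Eta - L) (Theta i j) = a i j.
  by rewrite /Eta addrAC subrr add0r tinner_coord.
have coord_cvg i j :
    tinner (Xi (t m) - L) (Theta i j) @[m --> \oo] --> tinner (Eta - L) (Theta i j).
  by rewrite EtaE; apply: ut; rewrite mem_enum.
have Eta_cvg : tcvg (Xi \o t) Eta.
  apply: (tcvg_coord hTheta) => i j.
  rewrite -(subrK L Eta) tinnerDl.
  under eq_fun do rewrite /= -(subrK L (Xi _)) tinnerDl.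
  by apply: cvgD => //; exact: cvg_cst.
exists t => //; exists Eta => //; split.
  by apply: (tclosed_cvg hS _ Eta_cvg) => m; exact: (hXi _).1.
move=> Z SZ.
have kappat i j : (fun m => kappa (t m) i j) @ \oo --> 0.
  exact: (cvg_subseq t_lt (hkappa i j)).
(* Passage to the limit on both sides of the minimality inequality against [Z]. *)
apply: (ler_cvg_to (curvF_cvg hTheta kappat coord_cvg) (cvg_subseq t_lt (F_cvg Z))).
by apply: nearW => m; exact: (hXi _).2.
Unshelve. all: by end_near. Qed.

End TensorInner.

(** * From subsequences to the whole sequence *)

Lemma not_near_subseq (P : nat -> Prop) :
  ~ (\forall m \near \oo, P m) ->
  exists2 s : nat -> nat, {homo s : a b / (a < b)%N} & forall m, ~ P (s m).
Proof.
move=> nP; have next N : exists m, (N <= m)%N /\ ~ P m.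
  apply: contrapT => /forallNP noP; apply: nP; exists N => // m /= Nm.
  by apply: contrapT => nPm; exact: (noP m).
have /choice[f fP] := next.
(* Each search starts just past the previous index, which makes [s] strictly increasing. *)
pose s := fix s k := if k is k'.+1 then f (s k').+1 else f 0%N.
exists s => [|m]; last by case: m => [|m]; exact: (fP _).2.
by apply: homo_ltn => [? ? ?|m]; [exact: ltn_trans|exact: (fP _).1].
Qed.

(** For a general closed [S] the set [A] may have several points, and the minimizers may oscillate
    between them. Convergence is therefore stated towards the set [A], along subsequences, and in
    the plain sense when [A] is a singleton. *)
Theorem theorem4p7 (R : realType) (d : nat) (M : riemannianManifold R d) (p : M)
    (n : nat) (dims : 'I_n -> nat)
    (S : set (tangent_tensor p dims))
    (G : set (tangent p)) (hG : exp_diffeo_on G)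
    (X : {ffun multi_index dims -> M})
    (hX : forall i, (@rexp R d M p @` G) (X i))
    (kappa : nat -> multi_index dims -> 'I_d -> R)
    (hkappa : forall i j, (fun m => kappa m i j) @ \oo --> 0)
    (Theta : multi_index dims -> 'I_d -> tangent_tensor p dims)
    (hTheta : orthonormal_basis Theta)
    (hS : tclosed S)
    (Xi : nat -> tangent_tensor p dims)
    (hXi : forall m, argmin (curvF G X Theta (kappa m)) S (Xi m)) :
  let A : set (tangent_tensor p dims) :=
    argmin (fun Eta => tnorm (Eta - tlog G X) ^+ 2) S in
  [/\ forall e : R, 0 < e ->
        \forall m \near \oo, exists2 Eta, A Eta & tnorm (Xi m - Eta) < e,
      forall s : nat -> nat, {homo s : a b / (a < b)%N} ->
        exists2 t : nat -> nat, {homo t : a b / (a < b)%N} &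
          exists2 Eta, A Eta & tcvg (Xi \o s \o t) Eta
    & forall Eta, A = [set Eta] -> tcvg Xi Eta].
Proof.
move=> A.
have subseq (s : nat -> nat) : {homo s : a b / (a < b)%N} ->
    exists2 t : nat -> nat, {homo t : a b / (a < b)%N} &
      exists2 Eta, A Eta & tcvg (Xi \o s \o t) Eta.
  (* A subsequence of [Xi] is again a sequence of minimizers, for the curvatures [kappa \o s]. *)
  move=> s_lt; apply: (curvF_argmin_subseq (kappa := kappa \o s) _ hTheta hS) => [i j|m].
    exact: (cvg_subseq s_lt (hkappa i j)).
  exact: hXi.
have near_A (e : R) : 0 < e ->
    \forall m \near \oo, exists2 Eta, A Eta & tnorm (Xi m - Eta) < e.
  (* Otherwise some subsequence stays at distance at least [e] from [A], although a further one
     converges to a point of [A]. *)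
  move=> e0; apply: contrapT => /not_near_subseq[s s_lt far].
  have [t _ [Eta AEta]] := subseq s s_lt.
  move=> /cvgrPdist_lt/(_ e e0)[N _ /(_ N (leqnn N))] /=.
  rewrite sub0r normrN ger0_norm ?sqrtr_ge0// => close.
  by apply: (far (t N)); exists Eta.
split=> // Eta AE; apply/cvgrPdist_lt => e /near_A.
apply: filterS => m [Z]; rewrite AE => -> XiZ.
by rewrite sub0r normrN ger0_norm ?sqrtr_ge0.
Qed.
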